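(* Let $F$ be a graph with $\ell\ge 2$ vertices. Then $$W^*[F]>\tfrac12\,\ell-2\log_2\ell+2.$$
   Context: Graphs are finite, simple, undirected, without loops. Consider first-order sentences about graphs in the language whose only relations are adjacency $\sim$ and equality $=$. The variable width of a sentence is the number of distinct variables occurring in it (a variable with several occurrences counts once). A sentence distinguishes two graphs if it is true on one and false on the other. For non-isomorphic graphs $G,H$, let $W(G,H)$ be the minimum variable width of a sentence distinguishing $G$ and $H$. Write $F\sqsubset G$ if $G$ contains an induced subgraph isomorphic to $F$. Define $W^*[F]=\max\{W(G,H): F\sqsubset G,\ F\not\sqsubset H\}$ (equivalently, the minimum $k$ such that the class of graphs containing an induced copy of $F$ is definable in the infinitary logic $L^k_{\infty\omega}$). *)

(* Defs.v *)
From HB Require Import structures.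
From mathcomp Require Import all_boot all_order all_algebra.
From mathcomp Require Import boolp classical_sets reals exp.

Set Implicit Arguments.
Unset Strict Implicit.
Unset Printing Implicit Defensive.

Import Order.TTheory GRing.Theory Num.Theory.

Record sgraph := SGraph {
  vertex :> finType;
  adj : rel vertex;
  adj_sym : symmetric adj;
  adj_irrefl : irreflexive adj
}.

Section Induced.
Variables (G : sgraph) (S : {set G}).

Definition induced_adj : rel {x : G | x \in S} :=
  fun u v => adj (val u) (val v).

Lemma induced_adj_sym : symmetric induced_adj.
Proof. by move=> u v; apply: adj_sym. Qed.

Lemma induced_adj_irrefl : irreflexive induced_adj.
Proof. by move=> u; apply: adj_irrefl. Qed.

Definition induced : sgraph := SGraph induced_adj_sym induced_adj_irrefl.
End Induced.

Definition isomorphic (F G : sgraph) : Prop :=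
  exists2 f : F -> G, bijective f & forall x y, adj (f x) (f y) = adj x y.

Definition induced_in (F G : sgraph) : Prop :=
  exists S : {set G}, isomorphic F (induced S).

Inductive formula : Type :=
  | FAdj of nat & nat
  | FEq of nat & nat
  | FNot of formula
  | FAnd of formula & formula
  | FOr of formula & formula
  | FImp of formula & formula
  | FEx of nat & formula
  | FAll of nat & formula.

Fixpoint vars (p : formula) : seq nat :=
  match p with
  | FAdj x y | FEq x y => [:: x; y]
  | FNot q => vars q
  | FAnd q r | FOr q r | FImp q r => vars q ++ vars r
  | FEx x q | FAll x q => x :: vars q
  end.

Fixpoint free_vars (p : formula) : seq nat :=
  match p with
  | FAdj x y | FEq x y => [:: x; y]
  | FNot q => free_vars q
  | FAnd q r | FOr q r | FImp q r => free_vars q ++ free_vars r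
  | FEx x q | FAll x q => [seq y <- free_vars q | y != x]
  end.

Definition sentence (p : formula) : bool := free_vars p == [::].

(* Rebinding a variable counts only once. *)
Definition width (p : formula) : nat := size (undup (vars p)).

(* Assignments are partial so that sentences also have a truth value on the
   graph with no vertices.  The value of an atom with an unassigned variable is
   immaterial: it is never reached when evaluating a sentence from the empty
   assignment. *)
Definition assignment (G : sgraph) := nat -> option G.

Definition assign (G : sgraph) (e : assignment G) (x : nat) (v : G) :
  assignment G := fun y => if y == x then Some v else e y.

Fixpoint eval (G : sgraph) (e : assignment G) (p : formula) : bool :=
  match p with
  | FAdj x y => if (e x, e y) is (Some u, Some v) then adj u v else false
  | FEq x y => if (e x, e y) is (Some u, Some v) then u == v else false
  | FNot q => ~~ eval e q
  | FAnd q r => eval e q && eval e r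
  | FOr q r => eval e q || eval e r
  | FImp q r => eval e q ==> eval e r
  | FEx x q => [exists v : G, eval (assign e x v) q]
  | FAll x q => [forall v : G, eval (assign e x v) q]
  end.

Definition true_on (G : sgraph) (p : formula) : bool :=
  eval (fun _ => None : option G) p.

Definition distinguishes (p : formula) (G H : sgraph) : Prop :=
  sentence p /\ true_on G p <> true_on H p.

(* Minimum and maximum of a set of naturals; the default value 0 is returned
   only when the minimum (resp. maximum) does not exist. *)
Definition min_of (A : set nat) : nat :=
  xget 0 (fun k => A k /\ forall j, A j -> k <= j).

Definition max_of (A : set nat) : nat :=
  xget 0 (fun k => A k /\ forall j, A j -> j <= k).

Definition W (G H : sgraph) : nat :=
  min_of (fun k => exists2 p, distinguishes p G H & width p = k).

(* If F has a vertex, the set below is nonempty (take G := F and H without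
   vertices) and bounded by #|F|, since the existence of an induced copy of F
   is expressed by a sentence of width #|F|; hence the maximum exists. *)
Definition Wstar (F : sgraph) : nat :=
  max_of (fun k =>
    exists G H : sgraph, [/\ induced_in F G, ~ induced_in F H & W G H = k]).

Definition log2 (R : realType) (x : R) : R := (ln x / ln 2)%R.

(* Main.v *)
(** Two graphs that both have the [s]-extension property (every 0/1 adjacency
    pattern on at most [s] vertices is realised by a further vertex) satisfy the
    same sentences with [s.+1] variables, since partial isomorphisms on [s]
    vertices always extend.  With [l := #|F|], a random graph on
    [n ~ 2 ^ ((l - 2) / 2)] vertices contains no induced copy of [F] with
    probability more than 1/2, by a union bound over the at most [n ^ l]
    embeddings, each of probability [2 ^ - 'C(l, 2)].  With probability at least
    1/2 it also has the [s]-extension property for the least [s] such that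
    [l / 2 - 2 * log2 l < s].  A graph with the extension property for
    [maxn s l] contains [F], so the two graphs are separated only by sentences
    of width at least [s + 2].  When [s = 0] a single vertex replaces the random
    graph. *)
Require Import Defs.
From HB Require Import structures.
From mathcomp Require Import all_boot all_order all_algebra.
From mathcomp Require Import boolp classical_sets reals exp.
From mathcomp Require Import zify lra.

Set Implicit Arguments.
Unset Strict Implicit.
Unset Printing Implicit Defensive.

Import Order.TTheory GRing.Theory Num.Theory.

(** * Pebble games on graphs with the extension property *)

(** Only the trace of [C] on [S] matters. Taking [S] empty shows that such a graph has a vertex. *)
Definition extension (s : nat) (G : sgraph) : Prop :=
  forall S C : {set G}, #|S| <= s ->
  exists2 v, v \notin S & forall y, y \in S -> adj v y = (y \in C).

Lemma extensionW (s t : nat) (G : sgraph) :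
  s <= t -> extension t G -> extension s G.
Proof. by move=> st extG S C Ss; apply: extG; apply: leq_trans st. Qed.

Lemma induced_inP (F G : sgraph) :
  induced_in F G <->
  exists2 f : F -> G, injective f & forall x y, adj (f x) (f y) = adj x y.
Proof.
split=> [[S [f /bij_inj f_inj f_adj]]|[f f_inj f_adj]].
  exists (val \o f); first exact: inj_comp val_inj f_inj.
  by move=> x y; rewrite -f_adj.
have fS x : f x \in [set f x | x in F] by apply: imset_f.
exists [set f x | x in F], (fun x => exist _ (f x) (fS x)) => //.
have g_ex (u : {v : G | v \in [set f x | x in F]}) : exists x, f x == val u.
  by case: u => v /= /imsetP[x _ ->]; exists x.
exists (fun u => xchoose (g_ex u)) => [x|u].
  by apply: f_inj; apply/eqP; apply: (xchooseP (g_ex _)).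
by apply: val_inj; apply/eqP; apply: (xchooseP (g_ex _)).
Qed.

(** A position of the pebble game with the variables in [X] as pebbles: the same pebbles are placed
    in both graphs, and they mark a partial isomorphism. *)
Definition partial_iso (X : seq nat) (G H : sgraph)
    (e : assignment G) (e' : assignment H) : Prop :=
  {in X, forall x, isSome (e x) = isSome (e' x)} /\
  {in X &, forall x y u v u' v',
    e x = Some u -> e y = Some v -> e' x = Some u' -> e' y = Some v' ->
    (u == v) = (u' == v') /\ adj u v = adj u' v'}.

Lemma partial_iso_sym (X : seq nat) (G H : sgraph)
    (e : assignment G) (e' : assignment H) :
  partial_iso X e e' -> partial_iso X e' e.
Proof.
case=> dom_e iso_e; split=> [x /dom_e //|x y xX yX u v u' v' eu ev eu' ev'].
by have [-> ->] := iso_e x y xX yX _ _ _ _ eu' ev' eu ev.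
Qed.

(** Duplicator's answer when pebble [x] moves to [v]: at most [s] other pebbles remain, so the
    extension property of [H] finds a vertex related to them as [v] is to their partners. *)
Lemma partial_iso_assign (s : nat) (X : seq nat) (G H : sgraph)
    (e : assignment G) (e' : assignment H) (x : nat) (v : G) :
  uniq X -> size X <= s.+1 -> x \in X -> extension s H -> partial_iso X e e' ->
  exists v', partial_iso X (assign e x v) (assign e' x v').
Proof.
move=> X_uniq X_size xX extH [dom_e iso_e]; pose Y := rem x X.
have memY y : (y \in Y) = (y != x) && (y \in X) by rewrite mem_rem_uniq ?inE.
suff [v' v'P] : exists v', {in Y, forall y u u',
    e y = Some u -> e' y = Some u' ->
    (v == u) = (v' == u') /\ adj v u = adj v' u'}.
  exists v'; split=> [y yX|y z yX zX a b a' b']; rewrite /assign.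
    by case: eqP => // _; apply: dom_e.
  have [_|yx] := eqVneq y x; have [_|zx] := eqVneq z x.
  - by move=> [<-] [<-] [<-] [<-]; rewrite !eqxx !adj_irrefl.
  - by move=> [<-] ez [<-] e'z; apply: (v'P z); rewrite ?memY ?zx.
  - move=> ey [<-] e'y [<-]; rewrite eq_sym [a' == _]eq_sym.
    rewrite adj_sym [RHS in _ /\ _ = RHS]adj_sym.
    by apply: (v'P y); rewrite ?memY ?yx.
  - exact: iso_e.
(* If [v] already carries another pebble [y], the partner of [y] is the answer; the extension
   property only supplies fresh vertices. *)
have [/hasP[y yY /eqP ey]|/hasPn vY] := boolP (has (fun y => e y == Some v) Y).
  move: (yY); rewrite memY => /andP[_ yX].
  have := dom_e y yX; rewrite ey; case e'y: (e' y) => [v'|] // _.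
  exists v' => z; rewrite memY => /andP[_ zX] u u' ez e'z.
  exact: (iso_e y z yX zX _ _ _ _ ey ez e'y e'z).
pose S := [set u in pmap e' Y].
pose C := [set u' | has (fun y => (e' y == Some u') &&
  (if e y is Some u then adj v u else false)) Y].
have S_size : #|S| <= s.
  rewrite cardsE (leq_trans (card_size _)) // size_pmap (leq_trans (count_size _ _)) //.
  by rewrite size_rem // -ltnS prednK ?(leq_trans _ X_size) //; case: (X) xX.
have [v' v'S v'C] := extH S C S_size; exists v' => y yY u u' ey e'y.
have u'S : u' \in S by rewrite inE mem_pmap -e'y map_f.
have yX : y \in X by move: yY; rewrite memY => /andP[].
split.
  rewrite [v' == _](negbTE (contraNneq _ v'S)) => [|->] //.
  by apply: contraNF (vY y yY) => /eqP ->; rewrite ey.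
rewrite v'C // inE; apply/idP/hasP => [vu|[z zY /andP[/eqP e'z]]].
  by exists y => //; rewrite e'y eqxx ey.
(* The pebble [z] that put [u'] into [C] may differ from [y], but both mark [u'], so they mark the
   same vertex of [G]. *)
move: (zY); rewrite memY => /andP[_ zX].
case ez: (e z) => [w|] // vw.
by have [] := iso_e y z yX zX _ _ _ _ ey ez e'y e'z; rewrite eqxx => /eqP ->.
Qed.

(** Each quantifier is one round of the game, answered in [H] or in [G]. The set [X] stays fixed,
    since a rebound variable reuses its pebble. *)
Lemma eval_partial_iso (s : nat) (X : seq nat) (G H : sgraph) (p : formula)
    (e : assignment G) (e' : assignment H) :
  uniq X -> size X <= s.+1 -> extension s G -> extension s H ->
  {subset vars p <= X} -> partial_iso X e e' -> eval e p = eval e' p.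
Proof.
move=> X_uniq X_size extG extH.
elim: p e e' => [x y|x y|q IHq|q IHq r IHr|q IHq r IHr|q IHq r IHr|x q IHq|x q IHq]
  e e' /= pX iso_e; try by rewrite (IHq _ _ pX iso_e).
1,2: have xX : x \in X by apply: pX; rewrite !inE eqxx.
1,2: have yX : y \in X by apply: pX; rewrite !inE eqxx orbT.
1,2: have [dom_e {}iso_e] := iso_e; have := dom_e x xX; have := dom_e y yX.
1,2: case ex: (e x) => [u|]; case ey: (e y) => [v|];
  case e'x: (e' x) => [u'|]; case e'y: (e' y) => [v'|] // _ _;
  by have [] := iso_e x y xX yX _ _ _ _ ex ey e'x e'y.
1-3: by rewrite (IHq _ _ _ iso_e) ?(IHr _ _ _ iso_e) // => z zp; apply: pX;
  rewrite mem_cat zp ?orbT.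
all: have xX : x \in X by apply: pX; rewrite inE eqxx.
all: have qX : {subset vars q <= X} by move=> z zq; apply: pX; rewrite inE zq orbT.
all: have forth := partial_iso_assign _ X_uniq X_size xX extH iso_e.
all: have back := partial_iso_assign _ X_uniq X_size xX extG (partial_iso_sym iso_e).
- apply/existsP/existsP => [[v vq]|[v' v'q]].
    by have [v' iso_v] := forth v; exists v'; rewrite -(IHq _ _ qX iso_v).
  by have [v /partial_iso_sym iso_v] := back v'; exists v; rewrite (IHq _ _ qX iso_v).
- apply/forallP/forallP => [vq v'|v'q v].
    by have [v /partial_iso_sym iso_v] := back v'; rewrite -(IHq _ _ qX iso_v).
  by have [v' iso_v] := forth v; rewrite (IHq _ _ qX iso_v).
Qed.

(** The game starts with no pebble placed, and [undup (vars p)] supplies the pebbles. *)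
Lemma extension_width (s : nat) (G H : sgraph) (p : formula) :
  extension s G -> extension s H -> distinguishes p G H -> s.+1 < width p.
Proof.
move=> extG extH [_]; apply: contra_notT; rewrite -leqNgt => p_width.
apply: (eval_partial_iso (undup_uniq _) p_width extG extH) => //.
by move=> x; rewrite mem_undup.
Qed.

(** * Defining the induced copies of a graph *)

Section Pattern.
Variable F : sgraph.

Definition signed (b : bool) (p : formula) := if b then p else FNot p.

Definition literal (i j : 'I_#|F|) : formula :=
  FAnd (signed (i == j) (FEq i j))
       (signed (adj (enum_val i) (enum_val j)) (FAdj i j)).

(* [FEq 0 0] stands for truth; variable 0 is assigned whenever [F] has a vertex. *)
Definition diagram : formula :=
  foldr FAnd (FEq 0 0) [seq literal ij.1 ij.2 | ij <- enum {: 'I_#|F| * 'I_#|F|}].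

Definition pattern : formula := foldr FEx diagram (iota 0 #|F|).

Hypothesis F_gt0 : 0 < #|F|.

Lemma diagram_vars : {subset vars diagram <= iota 0 #|F|}.
Proof.
rewrite /diagram; elim: (enum _) => [|[i j] r IHr] x /=.
  by rewrite !inE orbb => /eqP ->; rewrite mem_iota.
have litP b c : x \in vars (FAnd (signed b (FEq i j)) (signed c (FAdj i j))) -> x < #|F|.
  by case: b; case: c; rewrite /= !inE => /or4P[] /eqP ->.
rewrite mem_cat => /orP[/litP|]; first by rewrite mem_iota.
exact: IHr.
Qed.

Lemma diagram_free : free_vars diagram = vars diagram.
Proof.
rewrite /diagram; elim: (enum _) => [|[i j] r IHr] //=.
by rewrite IHr /literal /signed; do 2![case: ifP => _].
Qed.

Lemma pattern_sentence : sentence pattern.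
Proof.
have free_foldr l : free_vars (foldr FEx diagram l)
    = [seq x <- free_vars diagram | x \notin l].
  elim: l => [|y l IHl] /=; first by rewrite filter_predT.
  by rewrite IHl -filter_predI; apply: eq_filter => x /=; rewrite inE negb_or.
rewrite /sentence /pattern free_foldr diagram_free -size_eq0 size_filter.
by rewrite -leqn0 leqNgt -has_count; apply/hasPn => x /diagram_vars ->.
Qed.

Lemma pattern_width : width pattern <= #|F|.
Proof.
rewrite -[leqRHS](size_iota 0); apply: uniq_leq_size; first exact: undup_uniq.
move=> x; rewrite mem_undup /pattern.
have: {subset iota 0 #|F| <= iota 0 #|F|} by [].
elim: {1 3}(iota 0 #|F|) => [_|y l IHl sub] /=; first exact: diagram_vars.
rewrite inE => /orP[/eqP ->|]; first by apply: sub; rewrite inE eqxx.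
by apply: IHl => z zl; apply: sub; rewrite inE zl orbT.
Qed.

(** Merges a block of quantifiers into a single choice of a partial assignment, so that the pattern
    speaks directly of maps from [F]. *)
Lemma eval_exists (G : sgraph) (p : formula) (e : assignment G) (l : seq nat) :
  uniq l ->
  reflect (exists f : nat -> option G, [/\ {in l, forall x, isSome (f x)},
             {in [predC l], f =1 e} & eval f p]) (eval e (foldr FEx p l)).
Proof.
elim: l e => [|y l IHl] e /=.
  move=> _; apply: (iffP idP) => [ep|[f [_ fe]]]; first by exists e.
  by have -> : f = e by apply: funext => x; apply: fe.
move=> /andP[yl l_uniq]; apply: (iffP existsP).
  move=> [v /IHl[] // f [fl fe fp]]; exists f; split=> // x.
    rewrite inE => /orP[/eqP ->|/fl //].
    by rewrite fe ?inE // /assign eqxx.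
  by rewrite !inE negb_or => /andP[/negbTE xy xl]; rewrite fe // /assign xy.
move=> [f [fl fe fp]].
have := fl y; rewrite inE eqxx => /(_ isT); case fy: (f y) => [v|] // _.
exists v; apply/IHl => //; exists f; split=> // x.
  by move=> xl; apply: fl; rewrite inE xl orbT.
rewrite inE => xl; rewrite /assign; case: eqVneq => [->|xy] //.
by apply: fe; rewrite !inE negb_or xy.
Qed.

Lemma true_on_pattern (G : sgraph) : reflect (induced_in F G) (true_on G pattern).
Proof.
have eval_diagram (e : assignment G) (f : 'I_#|F| -> G) :
    (forall i : 'I_#|F|, e i = Some (f i)) ->
    reflect (forall i j, (f i == f j) = (i == j) /\
                         adj (f i) (f j) = adj (enum_val i) (enum_val j))
            (eval e diagram).
  move=> ef.
  have -> : eval e diagram = [forall ij, eval e (literal ij.1 ij.2)].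
    rewrite -[RHS](_ : all (fun ij => eval e (literal ij.1 ij.2))
                         (enum {: 'I_#|F| * 'I_#|F|}) = _).
      rewrite /diagram; elim: (enum _) => [|ij r IHr] /=; last by rewrite IHr.
      by rewrite (ef (Ordinal F_gt0)) eqxx.
    by apply/allP/forallP => [fP ij|fP ij _]; apply: fP; rewrite ?mem_enum.
  have lit i j : eval e (literal i j) = ((f i == f j) == (i == j)) &&
      (adj (f i) (f j) == adj (enum_val i) (enum_val j)).
    rewrite /literal /signed /=; congr (_ && _); case: ifP => _ /=;
      by rewrite !ef ?eqb_id ?eqbF_neg.
  apply: (iffP forallP) => [fP i j|fP [i j]].
    by have := fP (i, j); rewrite lit => /andP[/eqP -> /eqP ->].
  by rewrite lit /=; have [-> ->] := fP i j; rewrite !eqxx.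
apply: (iffP (eval_exists _ _ (iota_uniq _ _))).
  move=> [e [e_def _ e_diag]].
  have f_ex (i : 'I_#|F|) : {v | e i = Some v}.
    have := e_def i; rewrite mem_iota ltn_ord => /(_ isT); case: (e i) => // v _.
    by exists v.
  have /(eval_diagram e (fun i => sval (f_ex i)) (fun i => svalP (f_ex i))) fP := e_diag.
  apply/induced_inP; exists (fun x => sval (f_ex (enum_rank x))) => x y.
    by move=> /eqP; have [-> _] := fP (enum_rank x) (enum_rank y) => /eqP/enum_rank_inj.
  by have [_ ->] := fP (enum_rank x) (enum_rank y); rewrite !enum_rankK.
move=> /induced_inP[f f_inj f_adj].
(* [insub] leaves [e] undefined from [#|F|] on, where it must agree with the empty assignment. *)
pose e (x : nat) : option G := omap (f \o enum_val) (insub x : option 'I_#|F|).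
have eE (i : 'I_#|F|) : e i = Some (f (enum_val i)) by rewrite /e valK.
exists e; split=> [x|x|].
- by rewrite mem_iota => /= xF; rewrite -[x]/(val (Ordinal xF)) eE.
- by rewrite inE mem_iota /= => xF; rewrite /e insubF // (negbTE xF).
- apply/(eval_diagram _ _ eE) => i j.
  by rewrite f_adj (inj_eq f_inj) (inj_eq enum_val_inj).
Qed.

End Pattern.

(** * Lower bounds for [Wstar] from the extension property *)

Lemma min_ofP (A : set nat) (k : nat) : A k ->
  A (min_of A) /\ forall j, A j -> min_of A <= j.
Proof.
move=> Ak; have Aex : exists j, `[< A j >] by exists k; apply/asboolP.
rewrite /min_of; case: xgetP => [j -> //|/(_ (ex_minn Aex)) []].
by case: ex_minnP => j /asboolP Aj j_min; split=> // i Ai; apply: j_min; apply/asboolP.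
Qed.

Lemma max_of_ge (A : set nat) (k m : nat) :
  A k -> (forall j, A j -> j <= m) -> k <= max_of A.
Proof.
move=> Ak Am; have Aex : exists j, `[< A j >] by exists k; apply/asboolP.
have Abound j : `[< A j >] -> j <= m by move=> /asboolP; apply: Am.
rewrite /max_of; case: xgetP => [j -> [_ j_max]|/(_ (ex_maxn Aex Abound)) []].
  exact: j_max.
by case: ex_maxnP => j /asboolP Aj j_max; split=> // i Ai; apply: j_max; apply/asboolP.
Qed.

(** The sentence [pattern F] shows that each minimum [W] is attained and is at most [#|F|], so
    neither [W] nor [Wstar] takes its default value 0. *)
Lemma Wstar_ge (s : nat) (F G H : sgraph) : 0 < #|F| ->
  induced_in F G -> ~ induced_in F H -> extension s G -> extension s H ->
  s.+2 <= Wstar F.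
Proof.
move=> F_gt0 FG FH extG extH.
have pattern_dist G' H' : induced_in F G' -> ~ induced_in F H' ->
    distinguishes (pattern F) G' H'.
  move=> FG' FH'; split; first exact: pattern_sentence.
  move/(true_on_pattern F_gt0): FG' => ->.
  by move/(true_on_pattern F_gt0): FH' => /negbTE ->.
have W_attained G' H' : induced_in F G' -> ~ induced_in F H' ->
    (exists2 p, distinguishes p G' H' & width p = W G' H') /\
    forall j, (exists2 p, distinguishes p G' H' & width p = j) -> W G' H' <= j.
  move=> FG' FH'; apply: (@min_ofP _ (width (pattern F))).
  by exists (pattern F) => //; apply: pattern_dist.
have [[p p_dist p_width] _] := W_attained _ _ FG FH.
have := extension_width extG extH p_dist; rewrite p_width => /leq_trans; apply.
apply: (max_of_ge (m := #|F|)); first by exists G, H.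
move=> _ [G' [H' [FG' FH' <-]]]; apply: leq_trans (pattern_width F_gt0).
have [_] := W_attained _ _ FG' FH'; apply.
by exists (pattern F) => //; apply: pattern_dist.
Qed.

Local Open Scope ring_scope.

(** * Uniform Boolean functions *)

(** Uniform probability: the values of the function are independent fair coins indexed by [T]. *)
Definition pr (T : finType) (P : pred {ffun T -> bool}) : rat :=
  #|P|%:R / 2 ^+ #|T|.

Lemma prE (T : finType) (P : pred {ffun T -> bool}) :
  pr P = #|P|%:R / #|{ffun T -> bool}|%:R.
Proof. by rewrite /pr card_ffun card_bool natrX. Qed.

Section Probability.
Variable T : finType.
Implicit Types (P Q : pred {ffun T -> bool}) (A B : {set T}).

Lemma card_ffun_bool_neq0 : (#|{ffun T -> bool}|%:R : rat) != 0.
Proof. by rewrite card_ffun card_bool natrX expf_neq0. Qed.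

Lemma eq_pr P Q : P =1 Q -> pr P = pr Q.
Proof. by move=> PQ; rewrite /pr (eq_card PQ). Qed.

Lemma pr_le P Q : (forall g, P g -> Q g) -> pr P <= pr Q.
Proof.
move=> PQ; rewrite /pr ler_pM2r ?invr_gt0 ?exprn_gt0 // ler_nat.
by apply: subset_leq_card; apply/fintype.subsetP => g; apply: PQ.
Qed.

Lemma prT : pr (T := T) predT = 1.
Proof. by rewrite prE divff ?card_ffun_bool_neq0. Qed.

Lemma pr_compl P : pr (predC P) = 1 - pr P.
Proof.
apply/eqP; rewrite eq_sym subr_eq addrC !prE -mulrDl -natrD cardC.
by rewrite divff ?card_ffun_bool_neq0.
Qed.

Lemma pr_or P Q : pr (predU P Q) <= pr P + pr Q.
Proof.
rewrite /pr -mulrDl ler_pM2r ?invr_gt0 ?exprn_gt0 // -natrD ler_nat.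
by rewrite -cardUI leq_addr.
Qed.

Lemma pr_union (I : finType) (D : {set I}) (P : I -> pred {ffun T -> bool})
    (c : rat) :
  (forall i, i \in D -> pr (P i) <= c) ->
  pr (fun g => [exists i in D, P i g]) <= #|D|%:R * c.
Proof.
move=> Pc.
have le_sum : pr (fun g => [exists i in D, P i g]) <= \sum_(i in D) pr (P i).
  rewrite (eq_pr (Q := fun g => has (P^~ g) (enum D))); last first.
    move=> g; apply/existsP/hasP => [[i /andP[iD Pi]]|[i iD Pi]].
      by exists i; rewrite ?mem_enum.
    by exists i; rewrite -mem_enum iD.
  rewrite -big_enum /=; elim: (enum D) => [|i r IHr].
    by rewrite big_nil /pr (eq_card0 (A := fun _ => false)) ?mul0r.
  by rewrite big_cons (le_trans (pr_or _ _)) // lerD2l.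
apply: le_trans le_sum _; rewrite mulr_natl -sumr_const.
exact: ler_sum.
Qed.

Lemma pr_lt1_ex P : pr P < 1 -> exists g, ~~ P g.
Proof.
move=> P1; apply/existsP; apply: contraLR P1; rewrite negb_exists -leNgt.
move=> /forallP P_all; rewrite -prT; apply: pr_le => g _.
by have := P_all g; rewrite negbK.
Qed.

Definition depends_on A P :=
  forall f g : {ffun T -> bool}, {in A, f =1 g} -> P f = P g.

(* Swapping the coordinates in [A] between two independent samples [f], [g] is
   an involution that carries [P f && Q g] to [P f && Q f]. *)
Lemma pr_indep A B P Q : depends_on A P -> depends_on B Q -> [disjoint A & B] ->
  pr (predI P Q) = pr P * pr Q.
Proof.
move=> dP dQ disAB.
pose mix (f g : {ffun T -> bool}) := [ffun t => if t \in A then f t else g t].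
pose swap (fg : {ffun T -> bool} * {ffun T -> bool}) :=
  (mix fg.1 fg.2, mix fg.2 fg.1).
have swapK : involutive swap.
  by case=> f g; congr pair; apply/ffunP => t; rewrite !ffunE; case: (t \in A).
have card_swap : #|[pred fg | P fg.1 && Q fg.2]|
    = #|[pred fg : {ffun T -> bool} * {ffun T -> bool} |
          predI P Q fg.1 && predT fg.2]|.
  rewrite -(card_image (inv_inj swapK)); apply: eq_card => fg.
  rewrite -[fg in LHS]swapK (fintype.mem_image (inv_inj swapK)) !inE /= andbT.
  congr (_ && _); [apply: dP | apply: dQ] => t tA; rewrite ffunE ?tA //.
  by rewrite (disjointFl disAB tA).
have eqPQ : (#|P| * #|Q| = #|predI P Q| * #|{ffun T -> bool}|)%N.
  by rewrite -!cardX.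
rewrite !prE mulrACA -natrM eqPQ natrM mulrACA divff ?mulr1 //.
exact: card_ffun_bool_neq0.
Qed.

Lemma pr_indep_all (I : eqType) (r : seq I) (A : I -> {set T})
    (P : I -> pred {ffun T -> bool}) :
  uniq r -> (forall i, depends_on (A i) (P i)) ->
  {in r &, forall i j, i != j -> [disjoint A i & A j]} ->
  pr (fun g => all (P^~ g) r) = \prod_(i <- r) pr (P i).
Proof.
move=> r_uniq dP; elim: r r_uniq => [_ _|i r IHr /= /andP[ir r_uniq] disA].
  by rewrite big_nil -prT.
rewrite big_cons -IHr //; last first.
  by move=> j k jr kr; apply: disA; rewrite inE ?jr ?kr orbT.
(* The remaining conjunction depends only on the union of the sets [A j], which is disjoint from
   [A i]. *)
apply: (@pr_indep (A i) [set t | has (fun j => t \in A j) r]) => // [f g fg|].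
  apply: eq_in_all => j jr; apply: dP => t tA; apply: fg.
  by rewrite inE; apply/hasP; exists j.
rewrite disjoint_subset; apply/fintype.subsetP => t tAi.
rewrite !inE; apply/hasPn => j jr.
have ij : i != j by apply: contraNneq ir => ->.
by rewrite (disjointFr (disA i j _ _ ij) tAi) ?inE ?eqxx ?jr ?orbT.
Qed.

(** The event is a product set: one admissible value at each point of [A], two at every other
    point. *)
Lemma pr_fixed A (c : T -> bool) :
  pr (fun g => [forall t in A, g t == c t]) = 2^-1 ^+ #|A|.
Proof.
pose D t := [pred b | (t \in A) ==> (b == c t)].
have -> : pr (fun g => [forall t in A, g t == c t])
    = #|family D|%:R / 2 ^+ #|T| by [].
have cardD t : (#|D t| = if t \in A then 1 else 2)%N.
  case: ifP => tA; last by rewrite -card_bool; apply: eq_card => b; rewrite !inE tA.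
  by rewrite -(card1 (c t)); apply: eq_card => b; rewrite !inE tA.
have -> : #|family D| = (2 ^ #|~: A|)%N.
  rewrite card_family foldrE big_map big_enum /= -prod_nat_const.
  rewrite [RHS]big_mkcond; apply: eq_bigr => t _.
  by rewrite cardD inE; case: (t \in A).
by rewrite natrX -(cardsC A) exprD invfM mulrCA divff ?mulr1 ?exprVn ?expf_neq0.
Qed.

End Probability.

(* Bernoulli gives [2 <= (1 + 1/q)^q], and [(1 - 1/q)(1 + 1/q) <= 1]. *)
Lemma one_sub_inv_exp_le (q : nat) :
  (0 < q)%N -> (1 - q%:R^-1) ^+ q <= 2^-1 :> rat.
Proof.
move=> q_gt0; have q_gt0' : 0 < q%:R :> rat by rewrite ltr0n.
set x : rat := q%:R^-1.
have x_gt0 : 0 < x by rewrite invr_gt0.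
have x_le1 : x <= 1 by rewrite invf_le1 // ler1n.
have bernoulli m : 1 + m%:R * x <= (1 + x) ^+ m.
  elim: m => [|m IHm]; first by rewrite mul0r addr0 expr0.
  rewrite exprS; apply: le_trans (_ : (1 + x) * (1 + m%:R * x) <= _).
    have : 0 <= m%:R * x * x by rewrite !mulr_ge0 ?ler0n ?ltW.
    by rewrite -natr1; lra.
  by rewrite ler_pM2l // ltr_pwDl // ltW.
have two_le : 2 <= (1 + x) ^+ q.
  by have := bernoulli q; rewrite mulfV ?lt0r_neq0 //.
have prod_le : (1 - x) ^+ q * (1 + x) ^+ q <= 1.
  rewrite -exprMn exprn_ile1 //; first by rewrite mulr_ge0 //; lra.
  by have := mulr_gt0 x_gt0 x_gt0; lra.
have pow_ge0 : 0 <= (1 - x) ^+ q by rewrite exprn_ge0 // subr_ge0.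
nra.
Qed.

(** * Random graphs *)

Section RandomGraph.
Variable V : finType.
Implicit Type g : {ffun {set V} -> bool}.

(** Indexing the coins by the sets [[set x; y]] makes symmetry automatic; a uniform [g] gives the
    random graph with edge probability 1/2. *)
Definition pair_adj g : rel V := fun x y => (x != y) && g [set x; y].

Lemma pair_adj_sym g : symmetric (pair_adj g).
Proof. by move=> x y; rewrite /pair_adj eq_sym finset.setUC. Qed.

Lemma pair_adj_irrefl g : irreflexive (pair_adj g).
Proof. by move=> x; rewrite /pair_adj eqxx. Qed.

Definition pair_graph g : sgraph := SGraph (pair_adj_sym g) (pair_adj_irrefl g).

Definition embeds (F : sgraph) (f : {ffun F -> V}) g : bool :=
  injectiveb f && [forall x, forall y, pair_adj g (f x) (f y) == adj x y].

Lemma embedsP (F : sgraph) g :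
  induced_in F (pair_graph g) -> [exists f in [set: {ffun F -> V}], embeds f g].
Proof.
move=> /induced_inP[f f_inj f_adj]; apply/existsP; exists (finfun f).
rewrite inE /=; apply/andP; split.
  by apply/injectiveP => x y; rewrite !ffunE => /f_inj.
by apply/forallP => x; apply/forallP => y; rewrite !ffunE; apply/eqP/f_adj.
Qed.

(** An injective [f] sends the pairs of vertices of [F] to distinct coins, each with a prescribed
    value. *)
Lemma pr_embeds (F : sgraph) (f : {ffun F -> V}) :
  pr (embeds f) <= 2^-1 ^+ 'C(#|F|, 2).
Proof.
have [/injectiveP f_inj|f_ninj] := boolP (injectiveb f); last first.
  rewrite /pr (eq_card0 (A := embeds f)) ?mul0r ?exprn_ge0 // => g.
  by rewrite /in_mem /= /embeds (negbTE f_ninj).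
pose E := [set e : {set F} | #|e| == 2].
pose c (d : {set V}) := [exists x, exists y, (d == [set f x; f y]) && adj x y].
have -> : 'C(#|F|, 2) = #|[set f @: (e : {set F}) | e in E]|.
  by rewrite card_imset ?card_draws //; apply: imset_inj.
rewrite -(pr_fixed _ c); apply: pr_le => g /andP[_ /forallP fP].
have gP x y : x != y -> g [set f x; f y] = adj x y.
  move=> xy; have /forallP/(_ y)/eqP <- := fP x.
  by rewrite /pair_adj (inj_eq f_inj) xy.
apply/forallP => d; apply/implyP => /imsetP[e].
rewrite inE => /cards2P[x [y [xy ->]]] ->; rewrite imsetU1 imset_set1 gP //.
apply/eqP; apply/idP/existsP => [xy_adj|[x' /existsP[y' /andP[/eqP eq_xy]]]].
  by exists x; apply/existsP; exists y; rewrite eqxx.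
(* Both adjacencies are read off the same coin of [g], which avoids matching the two unordered pairs
   case by case. *)
move=> xy'_adj; rewrite -gP // eq_xy gP //.
by apply: contraTneq xy'_adj => ->; rewrite adj_irrefl.
Qed.

Lemma pr_induced_in (F : sgraph) :
  pr (fun g => `[< induced_in F (pair_graph g) >])
    <= (#|V| ^ #|F|)%:R * 2^-1 ^+ 'C(#|F|, 2).
Proof.
have -> : (#|V| ^ #|F|)%N = #|[set: {ffun F -> V}]| by rewrite cardsT card_ffun.
apply: le_trans (pr_union (fun f _ => pr_embeds f)).
by apply: pr_le => g /asboolP/embedsP.
Qed.

Definition unextended (SC : {set V} * {set V}) g : bool :=
  [forall v, (v \notin SC.1) ==>
    ~~ [forall y in SC.1, pair_adj g v y == (y \in SC.2)]].

(** The candidates [v] outside [S] use disjoint sets [A v] of coins, so their failures are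
    independent, each of probability [1 - 2^-1 ^+ #|S|]. *)
Lemma pr_unextended (S C : {set V}) :
  pr (unextended (S, C)) = (1 - 2^-1 ^+ #|S|) ^+ #|~: S|.
Proof.
pose A v := [set [set v; y] | y in S].
(* For [v] outside [S], the only element of [[set v; y]] in [S] is [y], so one function [c]
   prescribes the coins for all [v]. *)
pose c (t : {set V}) := [exists y, (y \in S) && (y \in t) && (y \in C)].
pose P v g := ~~ [forall t in A v, g t == c t].
have card_A v : v \notin S -> #|A v| = #|S|.
  move=> vS; apply: card_in_imset => x y xS yS /setP/(_ x).
  rewrite !inE eqxx orbT => /esym/orP[] /eqP // xv.
  by rewrite -xv xS in vS.
have PE v g : v \notin S ->
    ~~ [forall y in S, pair_adj g v y == (y \in C)] = P v g.
  move=> vS; rewrite /P.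
  have cE y : y \in S -> c [set v; y] = (y \in C).
    move=> yS; apply/existsP/idP => [[z]|yC]; last first.
      by exists y; rewrite yS yC !inE eqxx orbT.
    rewrite !inE => /andP[/andP[zS /orP[]/eqP zE] zC]; last by rewrite -zE.
    by rewrite -zE zS in vS.
  have adjE y : y \in S -> pair_adj g v y = g [set v; y].
    by move=> yS; rewrite /pair_adj; case: eqVneq => // vy; rewrite vy yS in vS.
  congr (~~ _); apply/forallP/forallP => [gP t|gP y].
    apply/implyP => /imsetP[y yS ->]; rewrite cE // -adjE //.
    by have := gP y; rewrite yS.
  apply/implyP => yS; rewrite adjE // -cE //.
  by have := gP [set v; y]; rewrite (imset_f (fun y => [set v; y])).
rewrite (eq_pr (Q := fun g => all (P^~ g) (enum (~: S)))); last first.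
  move=> g; apply/forallP/allP => /= [gP v|gP v].
    by rewrite mem_enum inE => vS; have := gP v; rewrite vS /= PE.
  by apply/implyP => vS; rewrite PE // gP // mem_enum inE.
rewrite (pr_indep_all (A := A)) ?enum_uniq //; first last.
- move=> v w; rewrite !mem_enum !inE => vS wS vw.
  rewrite -setI_eq0; apply/eqP/setP => t; rewrite !inE; apply/negbTE/negP.
  move=> /andP[/imsetP[y yS ->] /imsetP[z zS /setP/(_ v)]].
  rewrite !inE eqxx (negbTE vw) /= => /esym/eqP vz.
  by rewrite vz zS in vS.
- move=> v f g fg; rewrite /P; congr (~~ _).
  by apply: eq_forallb_in => t tA; rewrite fg.
rewrite big_enum /= -prodr_const; apply: eq_bigr => v; rewrite inE => vS.
by rewrite -(card_A v vS) -(pr_fixed _ c) -pr_compl.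
Qed.

(** When [V] has at least [s] elements, these types suffice: smaller sets are padded to size [s] in
    [unextendedP]. *)
Definition extension_types (s : nat) : {set {set V} * {set V}} :=
  [set SC : {set V} * {set V} | (#|SC.1| == s) && (SC.2 \subset SC.1)].

Lemma card_extension_types (s : nat) :
  (#|extension_types s| <= (2 * #|V|) ^ s)%N.
Proof.
rewrite -sum1_card; under eq_bigl do rewrite inE.
rewrite -(pair_big_dep (fun S : {set V} => #|S| == s)
            (fun S C : {set V} => C \subset S) (fun _ _ => 1%N)) /=.
have -> : (\sum_(S : {set V} | #|S| == s) \sum_(C : {set V} | C \subset S) 1
    = \sum_(S : {set V} | #|S| == s) 2 ^ s)%N.
  apply: eq_bigr => S /eqP <-; rewrite -card_powerset -sum1_card.
  by apply: eq_bigl => C; rewrite powersetE.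
rewrite sum_nat_cond_const card_draws expnMn mulnC leq_mul2l.
(* Multiplying by the factorial of [s] turns the binomial coefficient into a falling factorial,
   which is at most [#|V| ^ s]. *)
apply/orP; right; rewrite -(leq_pmul2r (fact_gt0 s)) bin_ffact.
rewrite (leq_trans _ (leq_pmulr _ (fact_gt0 s))) //.
elim: s => // s IHs; rewrite ffactnSr expnSr leq_mul ?leq_subr //.
Qed.

Lemma unextendedP (s : nat) g : (s <= #|V|)%N ->
  ~~ [exists SC in extension_types s, unextended SC g] ->
  extension s (pair_graph g).
Proof.
move=> sV g_ext S C Ss.
have [S' SS' S's] : exists2 S' : {set V}, S \subset S' & #|S'| = s.
  pose D : {set V} := [set x in take (s - #|S|) (enum (~: S))].
  have D_card : #|D| = (s - #|S|)%N.
    rewrite cardsE; have /card_uniqP -> := take_uniq (s - #|S|) (enum_uniq (~: S)).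
    rewrite size_take_min -cardE; apply/minn_idPl.
    by rewrite [#|~: S|]cardsCs finset.setCK leq_sub2r.
  have SD : [disjoint S & D].
    rewrite disjoint_subset; apply/fintype.subsetP => x xS; rewrite !inE.
    apply: contraL xS => /mem_take; rewrite mem_enum inE => //.
  exists (S :|: D); first exact: finset.subsetUl.
  by move: SD; rewrite -leq_card_setU => /eqP ->; rewrite D_card subnKC.
have := g_ext; rewrite negb_exists => /forallP/(_ (S', C :&: S')).
rewrite inE /= S's eqxx finset.subsetIr /= negb_forall => /existsP[v].
rewrite negb_imply negbK => /andP[vS' /forallP vP].
exists v; first by apply: contraNN vS'; apply: (fintype.subsetP SS').
move=> y yS; have := vP y; rewrite (fintype.subsetP SS') //= => /eqP.
by rewrite inE (fintype.subsetP SS') // andbT.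
Qed.

(** Union bound over the extension types. At least [2 ^ s * t] vertices lie outside a set of size
    [s], and each batch of [2 ^ s] of them fails with probability at most 1/2. *)
Lemma pr_not_extension (s t : nat) : (s + 2 ^ s * t <= #|V|)%N ->
  pr (fun g => ~~ `[< extension s (pair_graph g) >])
    <= ((2 * #|V|) ^ s)%:R * 2^-1 ^+ t.
Proof.
move=> stV; have sV : (s <= #|V|)%N by apply: leq_trans stV; rewrite leq_addr.
have bound SC : SC \in extension_types s -> pr (unextended SC) <= 2^-1 ^+ t.
  case: SC => S C; rewrite inE /= => /andP[/eqP Ss _]; rewrite pr_unextended Ss.
  have sub_ge0 : 0 <= 1 - 2^-1 ^+ s :> rat by rewrite subr_ge0 exprn_ile1.
  apply: le_trans (_ : (1 - 2^-1 ^+ s) ^+ (2 ^ s * t) <= _).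
    apply: ler_wiXn2l; rewrite ?sub_ge0 ?lerBlDr ?lerDl ?exprn_ge0 //.
    by rewrite [#|~: S|]cardsCs finset.setCK Ss; lia.
  rewrite exprM lerXn2r ?nnegrE ?exprn_ge0 // exprVn -natrX.
  by rewrite one_sub_inv_exp_le ?expn_gt0.
apply: le_trans (_ : #|extension_types s|%:R * 2^-1 ^+ t <= _).
  apply: le_trans (pr_union bound); apply: pr_le => g /asboolPn g_ext.
  by apply: contra_notT g_ext => g_ext; apply: unextendedP.
by rewrite ler_wpM2r ?exprn_ge0 // ler_nat card_extension_types.
Qed.

End RandomGraph.

(** * Graphs with the extension property, containing or avoiding [F] *)

Lemma extension_graph_exists (s : nat) : exists G : sgraph, extension s G.
Proof.
(* This [t] grows like [4 ^ s], while [(2 * n) ^ s] has only a quadratic exponent, at most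
   [s * (3 * s + 6)]. *)
pose t := (16 * 4 ^ s)%N; pose n := (s + 2 ^ s * t)%N.
have s_lt : (s < 2 ^ s)%N by apply: ltn_expl.
have tE : t = (16 * (2 ^ s * 2 ^ s))%N by rewrite /t -expnMn.
have n_le : (2 * n <= 2 ^ (3 * s + 6))%N.
  have -> : (2 ^ (3 * s + 6) = 64 * (2 ^ s * 2 ^ s * 2 ^ s))%N.
    by rewrite (_ : 3 * s + 6 = s + s + s + 6)%N ?expnD 1?mulnC //; lia.
  by rewrite /n tE; move: (2 ^ s)%N s_lt => a; nia.
have t_gt : (s * (3 * s + 6) < t)%N by rewrite tE; nia.
have : pr (fun g => ~~ `[< extension s (@pair_graph 'I_n g) >]) < 1.
  apply: le_lt_trans (pr_not_extension (t := t) _) _; first by rewrite card_ord.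
  rewrite card_ord exprVn ltr_pdivrMr ?exprn_gt0 // mul1r -natrX ltr_nat.
  apply: leq_ltn_trans (_ : (2 ^ (3 * s + 6)) ^ s < _)%N.
    by have [->//|s_gt0] := posnP s; rewrite leq_exp2r.
  by rewrite -expnM ltn_exp2l // mulnC.
by move=> /pr_lt1_ex[g]; rewrite negbK => /asboolP g_ext; exists (pair_graph g).
Qed.

(** Greedy embedding: the vertices of [F] are placed one at a time, each by one use of the extension
    property. *)
Lemma extension_induced_in (F G : sgraph) :
  extension #|F| G -> induced_in F G.
Proof.
move=> extG.
suff [f f_inj f_adj] : exists2 f : F -> G, {in enum F &, injective f}
    & {in enum F &, forall x y, adj (f x) (f y) = adj x y}.
  by apply/induced_inP; exists f => x y; [apply: f_inj | apply: f_adj]; rewrite mem_enum.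
elim: (enum F) (enum_uniq F) => [_|x l IHl /= /andP[xl /IHl[f f_inj f_adj]]].
  (* Before any vertex is placed, [f] must still be a total function, so some vertex of [G] is
     needed as its value. *)
  have [|v _ _] := extG finset.set0 finset.set0; first by rewrite finset.cards0.
  by exists (fun=> v).
pose S := [set f y | y in l]; pose C := [set f y | y in [set y in l | adj x y]].
have [|v vS vC] := extG S C.
  by apply: leq_trans (leq_imset_card _ _) (max_card _).
have fS y : y \in l -> f y \in S by move=> yl; apply: imset_f.
have vadj y : y \in l -> adj v (f y) = adj x y.
  move=> yl; rewrite vC ?fS //; apply/imsetP/idP => [[z]|xy].
    by rewrite inE => /andP[zl xz] /f_inj ->.
  by exists y; rewrite ?inE ?yl.
exists (fun z => if z == x then v else f z) => y z; rewrite !inE.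
  case: eqVneq => [->|_] /= yl; case: eqVneq => [->|_] //= zl.
  - by move=> vz; rewrite vz fS in vS.
  - by move=> yv; rewrite -yv fS in vS.
  - exact: f_inj.
case: eqVneq => [->|_] /= yl; case: eqVneq => [->|_] //= zl.
- by rewrite !adj_irrefl.
- exact: vadj.
- by rewrite adj_sym vadj // adj_sym.
- exact: f_adj.
Qed.

Lemma quartic_le_pow2 (m : nat) : (1 < m -> m ^ 4 <= 2 ^ m -> 16 <= m)%N.
Proof.
by do 16![case: m => [|m] //].
Qed.

(** The inequality says that [s - 1] is at most [l / 2 - 2 * log2 l]. It leaves room for a number
    [n] of vertices small enough to avoid [F] and large enough for the extension property. *)
Lemma free_extension_graph_exists (s : nat) (F : sgraph) :
  (0 < s)%N -> (4 ^ s.-1 * #|F| ^ 4 <= 2 ^ #|F|)%N -> (1 < #|F|)%N ->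
  exists2 H : sgraph, ~ induced_in F H & extension s H.
Proof.
set l := #|F| => s_gt0 s_le l_gt1.
have l_ge16 : (16 <= l)%N.
  apply: quartic_le_pow2 => //; apply: leq_trans s_le.
  by rewrite leq_pmull // expn_gt0.
(* With [l >= 16], the left side of [s_le] is at least [4 ^ s.-1 * 16 ^ 4 = 2 ^ (2 * s + 14)]. *)
have s2_le : (2 * s + 14 <= l)%N.
  rewrite -(@leq_exp2l 2) //; apply: leq_trans s_le.
  apply: leq_trans (_ : 4 ^ s.-1 * 16 ^ 4 <= _)%N.
    2: by rewrite leq_mul2l leq_exp2r ?l_ge16 ?orbT.
  rewrite -[4%N]/(2 ^ 2)%N -[16%N]/(2 ^ 4)%N -!expnM -expnD leq_exp2l //; lia.
(* [n] is the integer square root of [2 ^ (l - 2)]. Then [n ^ l] is at most 2 to the power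
   ['C(l, 2) - l / 2], so a copy of [F] has probability at most 2 to the power [- l / 2]. *)
have [n n_le n_gt] :
    exists2 n, (n ^ 2 <= 2 ^ (l - 2))%N & (2 ^ (l - 2) < n.+1 ^ 2)%N.
  have P0 : exists n, (n ^ 2 <= 2 ^ (l - 2))%N by exists 0%N.
  have Pb n : (n ^ 2 <= 2 ^ (l - 2) -> n <= 2 ^ (l - 2))%N.
    by move=> n_le; apply: leq_trans n_le; case: n => // n; rewrite -mulnn leq_pmulr.
  case: (ex_maxnP P0 Pb) => n n_le n_max; exists n => //.
  by rewrite ltnNge; apply/negP => /n_max; rewrite ltnn.
have pow_l : (2 ^ l = 4 * 2 ^ (l - 2))%N by rewrite -[4%N]/(2 ^ 2)%N -expnD subnKC.
(* Compared through squares, since [n] is known only through its square. *)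
have n_lower : (2 ^ s * l ^ 2 < 4 * n.+1)%N.
  rewrite -(@ltn_exp2r _ _ 2) // !expnMn.
  have -> : ((2 ^ s) ^ 2 * (l ^ 2) ^ 2 = 4 * (4 ^ s.-1 * l ^ 4))%N.
    by rewrite expnAC -{1}(prednK s_gt0) expnS -mulnA -(expnM l).
  by rewrite pow_l in s_le; nia.
(* The least [t] with [l * s + 2 <= 2 * t]. As [(2 * n) ^ 2 <= 2 ^ l], this makes [(2 * n) ^ s] at
   most half of [2 ^ t]. *)
pose t := ((l * s + 3) %/ 2)%N.
have t_ub : (2 * t <= l * s + 3)%N by rewrite /t; lia.
have t_lb : (l * s + 2 <= 2 * t)%N by rewrite /t; lia.
(* By [s2_le], [l ^ 2] exceeds [2 * l * s] by at least 12; this slack absorbs the summand [s] and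
   the rounding in [t] and [n]. *)
have st_le : (s + 2 ^ s * t <= n)%N.
  have s_lt : (s < 2 ^ s)%N by apply: ltn_expl.
  move: (2 ^ s)%N s_lt n_lower => a s_lt n_lower.
  have : (a * (2 * l * s + 12) <= a * l ^ 2)%N by rewrite leq_mul2l; nia.
  have : (a * (2 * t) <= a * (l * s + 3))%N by rewrite leq_mul2l t_ub orbT.
  nia.
have pr_ext : pr (fun g => ~~ `[< extension s (@pair_graph 'I_n g) >]) <= 2^-1.
  apply: le_trans (pr_not_extension (t := t) _) _; rewrite card_ord //.
  rewrite exprVn ler_pdivrMr ?exprn_gt0 // -[_ * 2 ^+ t]mulrC ler_pdivlMr //.
  rewrite -natrX -natrM ler_nat -(@leq_exp2r _ _ 2) // expnMn -!expnM.
  rewrite mulnC [(s * 2)%N]mulnC expnM [(t * 2)%N]mulnC.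
  apply: leq_trans (_ : 2 ^ 2 * (2 ^ l) ^ s <= _)%N.
    by rewrite leq_mul2l leq_exp2r // expnMn pow_l leq_mul2l n_le.
  by rewrite -expnM -expnD leq_exp2l // addnC.
have pr_ind : pr (fun g => `[< induced_in F (@pair_graph 'I_n g) >]) < 2^-1.
  apply: le_lt_trans (pr_induced_in _ _) _; rewrite card_ord -/l.
  rewrite exprVn ltr_pdivrMr ?exprn_gt0 // -[_ * 2 ^+ _]mulrC ltr_pdivlMr //.
  rewrite -natrX -natrM ltr_nat -(@ltn_exp2r _ _ 2) // expnMn -!expnM.
  rewrite [(l * 2)%N]mulnC expnM.
  apply: leq_ltn_trans (_ : (2 ^ (l - 2)) ^ l * 2 ^ 2 < _)%N.
    by rewrite leq_mul2r leq_exp2r ?n_le ?orbT //; lia.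
  rewrite -expnM -expnD ltn_exp2l //.
  have : ('C(l, 2) * 2 = l * l.-1)%N by rewrite mulnC -mul_bin_diag bin1.
  nia.
have : pr (predU (fun g => `[< induced_in F (@pair_graph 'I_n g) >])
                 (fun g => ~~ `[< extension s (@pair_graph 'I_n g) >])) < 1.
  apply: le_lt_trans (pr_or _ _) _; apply: lt_le_trans (ltr_leD pr_ind pr_ext) _.
  by rewrite -[2^-1]mul1r -splitr.
move=> /pr_lt1_ex[g]; rewrite /= negb_or negbK => /andP[/asboolPn ind /asboolP ext].
by exists (pair_graph g).
Qed.

(** * Logarithmic form of the choice of [s], and the final bound *)

Lemma lt_log2 (R : realType) (l s : nat) : (0 < l)%N ->
  (2 ^ l < 4 ^ s * l ^ 4)%N -> l%:R / 2 - 2 * log2 (l%:R : R) < s%:R.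
Proof.
move=> l_gt0 l_lt.
have l_pos : 0 < l%:R :> R by rewrite ltr0n.
have ln2_gt0 : 0 < ln 2 :> R by rewrite ln_gt0 // ltr1n.
have : ln (2 ^+ l : R) < ln (2 ^+ (2 * s) * l%:R ^+ 4).
  rewrite ltr_ln ?posrE ?mulr_gt0 ?exprn_gt0 // -!natrX -natrM ltr_nat expnM.
  exact: l_lt.
have lnX (x : R) m : 0 < x -> ln (x ^+ m) = m%:R * ln x.
  by move=> x_gt0; rewrite lnXn // mulr_natl.
rewrite lnM ?posrE ?exprn_gt0 // !lnX // natrM => ineq.
rewrite -(ltr_pM2r ln2_gt0) /log2 mulrBl.
rewrite -[2 * (_ / _) * _]mulrA divfK ?gt_eqF //.
lra.
Qed.

Theorem theorem3p7 (R : realType) (F : sgraph) (hF : (2 <= #|F|)%N) :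
  (Wstar F)%:R > #|F|%:R / 2 - 2 * log2 (#|F|%:R : R) + 2 :> R.
Proof.
have F_gt0 : (0 < #|F|)%N by apply: ltnW.
have s_ex : exists s, (2 ^ #|F| < 4 ^ s * #|F| ^ 4)%N.
  exists #|F|; apply: leq_trans (_ : (4 ^ #|F|).+1 <= _)%N.
    by rewrite ltnS leq_exp2r.
  rewrite -[X in (X < _)%N]muln1 ltn_mul2l expn_gt0 /=.
  by rewrite -[1%N](exp1n 4) ltn_exp2r.
case: (ex_minnP s_ex) => s s_gt s_min.
have [H FH extH] : exists2 H : sgraph, ~ induced_in F H & extension s H.
  have [s0|s_gt0] := posnP s; last first.
    apply: free_extension_graph_exists => //.
    (* By minimality of [s], its predecessor fails the strict inequality, which is the bound
       required here. *)
    by rewrite leqNgt; apply/negP => /s_min; lia.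
  exists (@pair_graph unit [ffun=> false]).
    move=> /induced_inP[f /leq_card]; rewrite card_unit; lia.
  move=> S C; rewrite s0 leqn0 finset.cards_eq0 => /eqP ->.
  by exists tt => [|y]; rewrite !inE.
have [G extG] := extension_graph_exists (maxn s #|F|).
have FG : induced_in F G.
  by apply: extension_induced_in; apply: extensionW extG; rewrite leq_maxr.
have := Wstar_ge F_gt0 FG FH (extensionW (leq_maxl _ _) extG) extH.
rewrite -(ler_nat R) => /(lt_le_trans _); apply.
by rewrite -[s.+2]addn2 natrD ltrD2r; apply: lt_log2.
Qed.
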